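(* Let $X$ be a topological space. The following statements are equivalent: (1) $X$ is $e^*\theta$-regular; (2) for each point $x\in X$ and each open set $U$ of $X$ containing $x$, there exists an $e^*$-$\theta$-open set $V$ containing $x$ such that $e^*\text{-}cl_\theta(V)\subseteq U$; (3) for each closed set $F$ of $X$, $F=\bigcap\{e^*\text{-}cl_\theta(V) : F\subseteq V,\ V \text{ is } e^*\text{-}\theta\text{-open in } X\}$; (4) for each subset $A$ of $X$ and each open set $U$ of $X$ such that $A\cap U\neq\emptyset$, there exists an $e^*$-$\theta$-open set $V$ of $X$ such that $A\cap V\neq\emptyset$ and $e^*\text{-}cl_\theta(V)\subseteq U$; (5) for each nonempty subset $A$ of $X$ and each closed set $F$ of $X$ such that $A\cap F=\emptyset$, there exist $e^*$-$\theta$-open sets $V,W$ of $X$ such that $A\cap V\neq\emptyset$, $F\subseteq W$ and $V\cap W=\emptyset$.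
   Context: For a subset $A$ of a topological space $X$, $cl(A)$ and $int(A)$ denote closure and interior. The $\delta$-closure $cl_\delta(A)$ is the set of points $x\in X$ such that $int(cl(U))\cap A\neq\emptyset$ for every open $U$ containing $x$. $A$ is $e^*$-open if $A\subseteq cl(int(cl_\delta(A)))$; complements of $e^*$-open sets are $e^*$-closed; $e^*\text{-}cl(A)$ is the intersection of all $e^*$-closed sets containing $A$. The $e^*$-$\theta$-closure $e^*\text{-}cl_\theta(A)$ is the set of points $x\in X$ such that $e^*\text{-}cl(U)\cap A\neq\emptyset$ for every $e^*$-open set $U$ containing $x$. $A$ is $e^*$-$\theta$-closed if $A=e^*\text{-}cl_\theta(A)$; complements of $e^*$-$\theta$-closed sets are called $e^*$-$\theta$-open. $X$ is $e^*\theta$-regular if for each closed set $F$ of $X$ and each point $x\notin F$ there exist disjoint $e^*$-$\theta$-open sets $U$ and $V$ with $F\subseteq U$ and $x\in V$. *)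

(* Defs.v *)
From mathcomp Require Import all_boot all_classical topology.

Set Implicit Arguments.
Unset Strict Implicit.
Unset Printing Implicit Defensive.

Local Open Scope classical_set_scope.

Section EStarTheta.
Context {X : topologicalType}.
Implicit Types A B U : set X.

Definition delta_closure A : set X :=
  [set x | forall U, open U -> U x -> interior (closure U) `&` A !=set0].

Definition estar_open A : Prop :=
  A `<=` closure (interior (delta_closure A)).

Definition estar_closed A : Prop := estar_open (~` A).

Definition estar_closure A : set X :=
  \bigcap_(B in [set B | estar_closed B /\ A `<=` B]) B.

Definition estar_theta_closure A : set X :=
  [set x | forall U, estar_open U -> U x -> estar_closure U `&` A !=set0].

Definition estar_theta_closed A : Prop := A = estar_theta_closure A.

Definition estar_theta_open A : Prop := estar_theta_closed (~` A).

End EStarTheta.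

Definition estar_theta_regular (X : topologicalType) : Prop :=
  forall (F : set X) (x : X), closed F -> ~ F x ->
    exists U V : set X, [/\ estar_theta_open U, estar_theta_open V,
      F `<=` U, V x & U `&` V = set0].

(* Main.v *)
(* The set A U int(cl(int_delta(A))) is e*-closed, so it contains e*-cl(A);
   hence the e*-closure of an e*-open set is again e*-open.  This makes the
   e*-theta-closure idempotent, so complements of e*-theta-closures are
   e*-theta-open, and the usual characterizations of regularity go through. *)
Require Import Defs.
From mathcomp Require Import all_boot all_classical topology.

Local Open Scope classical_set_scope.

Section EStarThetaClosure.
Context {X : topologicalType}.
Implicit Types A B U V : set X.

Definition delta_interior A : set X := ~` delta_closure (~` A).

Lemma delta_interiorP A x :
  delta_interior A x <->
  exists U, [/\ open U, U x & interior (closure U) `<=` A].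
Proof.
split=> [/existsNP[U /not_implyP[oU /not_implyP[Ux UA]]]|[U [oU Ux UA]] cA].
  exists U; split=> // y Uy; apply: contrapT => nAy; apply: UA; by exists y.
by have [y [/UA]] := cA U oU Ux.
Qed.

Lemma open_sub_regularization U : open U -> U `<=` interior (closure U).
Proof. by move=> oU; rewrite -open_subsetE//; exact: subset_closure. Qed.

Lemma delta_interior_sub A : delta_interior A `<=` A.
Proof.
move=> x /delta_interiorP[U [oU Ux]]; apply.
exact: open_sub_regularization.
Qed.

Lemma open_delta_interior A : open (delta_interior A).
Proof.
rewrite openE => x /delta_interiorP[U [oU Ux UA]].
suff : U `<=` interior (delta_interior A) by apply.
by rewrite -open_subsetE// => y Uy; apply/delta_interiorP; exists U.
Qed.

Lemma sub_delta_closure A : A `<=` delta_closure A.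
Proof.
by move=> x Ax U oU Ux; exists x; split=> //; exact: open_sub_regularization.
Qed.

Lemma delta_closureS A B : A `<=` B -> delta_closure A `<=` delta_closure B.
Proof.
by move=> AB x cA U oU Ux; have [y [? /AB ?]] := cA U oU Ux; exists y.
Qed.

Lemma estar_closedE A :
  estar_closed A <-> interior (closure (delta_interior A)) `<=` A.
Proof.
rewrite /estar_closed /estar_open /delta_interior closure_setC interiorC.
by split=> [/subsetC|/subsetC]; rewrite !setCK.
Qed.

(** Adding [interior (closure G)] to [A] creates no [delta_interior] points outside [closure G], so
    [interior (closure _)] of the new [delta_interior] is still within the part added. *)
Lemma estar_closed_hull A :
  estar_closed (A `|` interior (closure (delta_interior A))).
Proof.
set G := delta_interior A; apply/estar_closedE.
have sub : delta_interior (A `|` interior (closure G)) `<=` closure G.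
  move=> x /delta_interiorP[U [oU Ux UAG]].
  have [//|nGx] := pselect (closure G x).
  apply/subset_closure/delta_interiorP; exists (U `&` ~` closure G); split=> //.
    by apply: openI => //; exact/closed_openC/closed_closure.
  move=> y Vy; have [//|Gy] : (A `|` interior (closure G)) y.
    by apply: UAG; apply: interiorS Vy; apply: closureS => ? [].
  suff : closure (~` closure G) y by rewrite closure_setC.
  by apply: closureS (interior_subset Vy) => ? [].
apply: subset_trans (@subsetUr _ _ _); apply: interiorS.
by rewrite [X in _ `<=` X](closure_id _).1;
  [exact: closureS|exact: closed_closure].
Qed.

Lemma estar_closure_sub_hull A :
  estar_closure A `<=` A `|` interior (closure (delta_interior A)).
Proof.
by move=> x; apply; split; [exact: estar_closed_hull|exact: subsetUl].
Qed.

Lemma sub_estar_closure A : A `<=` estar_closure A.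
Proof. by move=> x Ax B [_]; apply. Qed.

Lemma estar_closure_idem A :
  estar_closure (estar_closure A) `<=` estar_closure A.
Proof. by move=> x Ax B BA; apply: Ax; split; [case: BA|exact: bigcap_inf]. Qed.

Lemma estar_open_closure A : estar_open A -> estar_open (estar_closure A).
Proof.
move=> oA x /[dup] Bx /estar_closure_sub_hull[Ax|].
  move: (oA _ Ax); apply/closureS/interiorS/delta_closureS.
  exact: sub_estar_closure.
(* For points that the hull adds, it suffices that [delta_interior A] is open and lies in [A], hence
   in the [delta_closure] of the e*-closure. *)
move=> /interior_subset; apply: closureS.
rewrite -open_subsetE; last exact: open_delta_interior.
apply: subset_trans (@delta_interior_sub A) _.
exact: subset_trans (@sub_estar_closure A) (@sub_delta_closure _).
Qed.

Lemma sub_estar_theta_closure A : A `<=` estar_theta_closure A.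
Proof.
by move=> x Ax U oU Ux; exists x; split=> //; exact: sub_estar_closure.
Qed.

Lemma estar_theta_closureS A B :
  A `<=` B -> estar_theta_closure A `<=` estar_theta_closure B.
Proof.
by move=> AB x cA U oU Ux; have [y [? /AB ?]] := cA U oU Ux; exists y.
Qed.

(** If [U] is e*-open, so is [estar_closure U], which can therefore serve as the test neighbourhood
    of a point [y] found in it; idempotence of the e*-closure removes the second closure. *)
Lemma estar_theta_closed_closure A : estar_theta_closed (estar_theta_closure A).
Proof.
apply/seteqP; split; first exact: sub_estar_theta_closure.
move=> x cA U oU Ux; have [y [Uy Ay]] := cA U oU Ux.
have [z [Uz Az]] := Ay _ (estar_open_closure _ oU) Uy.
by exists z; split=> //; exact: estar_closure_idem.
Qed.

Lemma estar_theta_open_closureC A : estar_theta_open (~` estar_theta_closure A).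
Proof.
by rewrite /estar_theta_open setCK; exact: estar_theta_closed_closure.
Qed.

Lemma estar_theta_closure_disjoint A V :
  estar_theta_open V -> A `&` V = set0 -> estar_theta_closure A `<=` ~` V.
Proof.
by move=> oV /disjoints_subset AV; rewrite oV; exact: estar_theta_closureS.
Qed.

(** Makes the exterior of [V] usable as the separating e*-theta-open set: even its e*-theta-closure
    misses [V]. *)
Lemma estar_theta_closure_exteriorC V :
  estar_theta_open V ->
  estar_theta_closure (~` estar_theta_closure V) `<=` ~` V.
Proof.
move=> oV; apply: estar_theta_closure_disjoint => //.
by apply/disjoints_subset/subsetC; exact: sub_estar_theta_closure.
Qed.

End EStarThetaClosure.

Theorem theorem1 (X : topologicalType) :
  [<->
    estar_theta_regular X;
    forall (x : X) (U : set X), open U -> U x ->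
      exists V : set X,
        [/\ estar_theta_open V, V x & estar_theta_closure V `<=` U];
    forall F : set X, closed F ->
      F = \bigcap_(V in [set V : set X | F `<=` V /\ estar_theta_open V])
            estar_theta_closure V;
    forall A U : set X, open U -> A `&` U !=set0 ->
      exists V : set X,
        [/\ estar_theta_open V, A `&` V !=set0 & estar_theta_closure V `<=` U];
    forall A F : set X, A !=set0 -> closed F -> A `&` F = set0 ->
      exists V W : set X,
        [/\ estar_theta_open V, estar_theta_open W, A `&` V !=set0,
            F `<=` W & V `&` W = set0]
  ].
Proof.
tfae.
- move=> reg x U oU Ux.
  have [||W [V [oW oV UW Vx WV]]] := reg (~` U) x.
  + exact: open_closedC.
  + by apply.
  exists V; split=> //; rewrite -[U]setCK.
  apply: subset_trans (subsetC UW).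
  by apply: estar_theta_closure_disjoint => //; rewrite setIC.
- move=> nbh F cF; apply/seteqP; split=> [x Fx V [FV _]|x Fx].
    exact/sub_estar_theta_closure/FV.
  apply: contrapT => nFx.
  have [V [oV Vx VF]] := nbh x _ (closed_openC cF) nFx.
  (* The exterior of [V] is a member of the intersected family, yet its e*-theta-closure omits
     [x]. *)
  apply: (estar_theta_closure_exteriorC _ oV x (Fx _ _) Vx).
  by split; [exact/subsetCr|exact: estar_theta_open_closureC].
- move=> cap A U oU [x [Ax Ux]].
  have : ~ (~` U) x by apply.
  rewrite (cap _ (open_closedC oU)) => /existsNP[V /not_implyP[[UV oV] nVx]].
  (* [V] contains the complement of [U] and its e*-theta-closure misses [x], so the exterior of [V]
     is the required neighbourhood. *)
  exists (~` estar_theta_closure V); split.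
  + exact: estar_theta_open_closureC.
  + by exists x.
  rewrite -[U]setCK; apply: subset_trans (subsetC UV).
  exact: estar_theta_closure_exteriorC.
- move=> meet A F [x Ax] cF AF.
  have [|V [oV AV VF]] := meet A (~` F) (closed_openC cF).
    by exists x; split=> // Fx; have : (A `&` F) x by []; rewrite AF.
  exists V, (~` estar_theta_closure V); split=> //.
  + exact: estar_theta_open_closureC.
  + exact/subsetCr.
  by apply/disjoints_subset; rewrite setCK; exact: sub_estar_theta_closure.
- move=> sep F x cF nFx.
  (* For a singleton, meeting [V] means that [x] lies in [V]. *)
  have [|||V [W [oV oW [y [-> Vx]] FW VW]]] := sep [set x] F.
  + by exists x.
  + by [].
  + by apply/disjoints_subset => y ->.
  by exists W, V; split=> //; rewrite setIC.
Qed.
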